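(* Every $(\aleph_0,\aleph_1)$-graph has a subgraph which is an almost disjoint $(\aleph_0,\aleph_1)$-graph.
   Context: An $(\aleph_0,\aleph_1)$-graph is a bipartite graph with bipartition $(A,B)$ such that $|A|=\aleph_0$, $|B|=\aleph_1$ and every vertex of $B$ has infinite degree. It is almost disjoint (AD) if any two distinct vertices of $B$ have only finitely many common neighbours. *)

(* Defs.v *)
From mathcomp Require Import all_boot.
From mathcomp Require Import boolp classical_sets functions cardinality.

Set Implicit Arguments.
Unset Strict Implicit.
Unset Printing Implicit Defensive.

Local Open Scope classical_set_scope.
Local Open Scope card_scope.

(* The vertex set is a subset of an ambient type, so that a graph and its
   subgraphs live over the same type. *)
Record graph (V : Type) := Graph {
  verts : set V;
  edge : V -> V -> Prop;
  edge_sym : forall x y, edge x y -> edge y x;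
  edge_irrefl : forall x, ~ edge x x;
  edge_verts : forall x y, edge x y -> verts x }.

Definition neighbours (V : Type) (G : graph V) (v : V) : set V :=
  [set w | edge G v w].

Definition subgraph (V : Type) (H G : graph V) : Prop :=
  verts H `<=` verts G /\ forall x y, edge H x y -> edge G x y.

Definition bipartition (V : Type) (G : graph V) (A B : set V) : Prop :=
  [/\ A `|` B = verts G,
      A `&` B = set0,
      forall x y, A x -> A y -> ~ edge G x y
    & forall x y, B x -> B y -> ~ edge G x y].

Definition card_aleph0 (T : Type) (A : set T) : Prop := A #= [set: nat].

(* aleph_1 is the least uncountable cardinal. *)
Definition card_aleph1 (T : Type) (B : set T) : Prop :=
  ~ countable B /\
  forall (U : Type) (C : set U), ~ countable C -> B #<= C.

Definition aleph01_graph (V : Type) (G : graph V) (A B : set V) : Prop :=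
  [/\ bipartition G A B, card_aleph0 A, card_aleph1 B
    & forall b, B b -> infinite_set (neighbours G b)].

Definition almost_disjoint (V : Type) (G : graph V) (B : set V) : Prop :=
  forall b c, B b -> B c -> b <> c ->
    finite_set (neighbours G b `&` neighbours G c).

(* Main.v *)
Require Import Defs.
From mathcomp Require Import all_boot.
From mathcomp Require Import boolp classical_sets functions cardinality.

Local Open Scope classical_set_scope.
Local Open Scope card_scope.

(** Shrinking neighbourhoods, it suffices to find an uncountable [C] in [B] and
    pairwise almost disjoint infinite subsets of the [N(b)], [b] in [C].
    Either every infinite set has an infinite subset [Y] meeting only countably
    many [N(b)] infinitely; then pick such a [Y_b] inside each [N(b)], so that
    each [Y_b] fails to be almost disjoint from only countably many [Y_c], and
    take a maximal pairwise almost disjoint subfamily. Or some infinite [X] has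
    all its infinite subsets meeting uncountably many [N(b)] infinitely; then
    take an uncountable almost disjoint family on [X], match its members [Y_f]
    injectively with indices [b] such that [N(b)] meets [Y_f] infinitely, and
    shrink [N(b)] to this intersection. *)

Lemma uncountable_notin {T : Type} {A C : set T} :
  ~ countable A -> countable C -> exists2 x, A x & ~ C x.
Proof.
move=> uA cC; apply: contrapT => noX; apply: uA; apply: sub_countable cC.
apply: subset_card_le => x Ax; apply: contrapT => nCx; apply: noX.
by exists x.
Qed.

(** Zorn gives a maximal clique. Were it countable, the extension hypothesis would supply a point
    related to all its members, and new to it because [r] is irreflexive. *)
Lemma uncountable_clique {T : Type} {S : set T} {r : T -> T -> Prop} :
  (forall x, ~ r x x) -> (forall x y, r x y -> r y x) ->
  (forall C, C `<=` S -> countable C ->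
     exists2 x, S x & forall y, C y -> r x y) ->
  exists M, [/\ M `<=` S, ~ countable M &
    forall x y, M x -> M y -> x <> y -> r x y].
Proof.
move=> irr sym ext.
pose P : set (set T) := [set M | M `<=` S /\
  forall x y, M x -> M y -> x <> y -> r x y].
have [F FP Ftot|M [[MS Mr] Mmax]] := @Zorn_bigcup T P.
  split=> [x [X FX Xx]|x y [X FX Xx] [Y FY Yy] nxy]; first exact: (FP _ FX).1.
  by have [/(_ _ Xx) Yx|/(_ _ Yy) Xy] := Ftot _ _ FX FY;
    [apply: (FP _ FY).2|apply: (FP _ FX).2].
exists M; split=> // cM.
have [x Sx rx] := ext M MS cM.
apply: (Mmax (x |` M)).
  split=> [y My|sub]; first by right.
  by apply: (irr x); apply: rx; apply: sub; left.
split=> [y [->|/MS]//|y z [->|My] [->|Mz] nyz]//.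
- exact: rx.
- exact/sym/rx.
- exact: Mr.
Qed.

Lemma cantor_notin {C : set (nat -> bool)} : countable C -> exists f, ~ C f.
Proof.
move=> /countable_injP[e einj].
(* Diagonalisation along the injection [e]: if this function were in [C], its value at its own code
   would be true exactly when it is false. *)
exists (fun n => `[< exists2 g, C g & e g = n /\ ~~ g n >]).
set f := (X in C X) => Cf.
case fE: (f (e f)).
  move/asboolP: (fE) => [g Cg [eg ng]].
  by move: ng; rewrite -eg (einj g f) ?inE// fE.
by move/asboolP: (fE); apply; exists f; rewrite ?fE.
Qed.

(* The branches of the binary tree, transported to [X]. *)
Lemma almost_disjoint_branches {U : Type} {X : set U} :
  infinite_set X ->
  exists Y : (nat -> bool) -> set U,
    [/\ forall f, Y f `<=` X, forall f, infinite_set (Y f) &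
      forall f g, f <> g -> finite_set (Y f `&` Y g)].
Proof.
move=> /infiniteP/card_leP[e0].
have [e [eX einj]] : exists e : seq bool -> U,
    (forall s, X (e s)) /\ injective e.
  have tX n : [set: nat] n by [].
  exists (fun s => val (e0 (SigSub (mem_set (tX (pickle s)))))); split.
    by move=> s; apply: set_valP.
  by move=> s t /val_inj /(inj (in_setT _) (in_setT _)) [] /(pcan_inj pickleK).
exists (fun f => range (fun n => e (mkseq f n))); split.
- by move=> f _ [n _ <-].
- move=> f; rewrite (eq_finite_set (inj_card_eq _)); first exact: infinite_nat.
  by move=> n m _ _ /einj /(congr1 size); rewrite !size_mkseq.
- move=> f g nfg; have [k fgk] : exists k, f k <> g k.
    apply: contrapT => nk; apply: nfg; apply: funext => k.
    by apply: contrapT => fgk; apply: nk; exists k.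
  (* Branches that differ at [k] share only prefixes of length at most [k]. *)
  apply: sub_finite_set (finite_image (fun n => e (mkseq f n)) (finite_II k.+1)).
  move=> _ [[n _ <-] [m _ /einj mn]]; exists n => //=.
  have mnE : m = n by move/(congr1 size): mn; rewrite !size_mkseq.
  rewrite ltnNge; apply/negP => kn; apply: fgk.
  by rewrite -(nth_mkseq true f kn) -mn mnE nth_mkseq.
Qed.

Lemma almost_disjoint_refinement {T U : Type} {B : set T} {N : T -> set U} :
  ~ countable B -> (forall b, B b -> infinite_set (N b)) ->
  exists (C : set T) (M : T -> set U),
    [/\ C `<=` B, ~ countable C,
      forall b, C b -> M b `<=` N b /\ infinite_set (M b) &
      forall b c, C b -> C c -> b <> c -> finite_set (M b `&` M c)].
Proof.
move=> uB infN.
pose meets (Y : set U) := [set b | B b /\ infinite_set (N b `&` Y)].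
have [thin|] := pselect (forall X, infinite_set X ->
    exists Y, [/\ Y `<=` X, infinite_set Y & countable (meets Y)]).
  have /choice[M MP] (b : T) : exists Y, B b ->
      [/\ Y `<=` N b, infinite_set Y & countable (meets Y)].
    have [/infN/thin[Y YP]|nBb] := pselect (B b); first by exists Y.
    by exists set0.
  have [|b c [nbc fbc]|C CB cC|C [CB uC Cr]] := @uncountable_clique T B
      (fun b c => b <> c /\ finite_set (M b `&` M c)).
  - by move=> b [].
  - by split; [exact: nesym|rewrite setIC].
  (* An index outside this union has [N b], hence [M b], almost disjoint from every earlier
     [M c]. *)
  - have cD : countable (\bigcup_(c in C) meets (M c)).
      by apply: bigcup_countable => // c /CB/MP[].
    have [b Bb nDb] := uncountable_notin uB cD; exists b => // c Cc.
    have [Mb infMb _] := MP b Bb.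
    have fbc : finite_set (M b `&` M c).
      apply: contrapT => infbc; apply: nDb; exists c => //; split => //.
      by apply: contra_not infbc; apply: sub_finite_set; exact: setSI.
    by split=> // bc; apply: infMb; move: fbc; rewrite -bc setIid.
  - exists C, M; split=> // [b /CB/MP[]//|b c Cb Cc nbc].
    by have [] := Cr b c Cb Cc nbc.
move=> /existsNP[X /not_implyP[infX thick]].
have [Y [YX infY adY]] := almost_disjoint_branches infX.
(* A clique for this relation is a matching: no index and no branch occurs in two of its pairs. *)
have [|p q [? ?]|C CS cC|M [MS uM Mr]] := @uncountable_clique (T * (nat -> bool))
    [set p | meets (Y p.2) p.1] (fun p q => p.1 <> q.1 /\ p.2 <> q.2).
- by move=> p [].
- by split; exact: nesym.
- have [f nCf] := cantor_notin (sub_countable (card_image_le snd C) cC).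
  have [|b Yb nCb] := @uncountable_notin _ (meets (Y f)) (fst @` C) _
      (sub_countable (card_image_le fst C) cC).
    (* Since [Y f] is an infinite subset of [X], uncountably many indices are available for the
       fresh branch [f]. *)
    by move=> cY; apply: thick; exists (Y f); split.
  exists (b, f) => //= p Cp; split=> [bp|fp]; [apply: nCb|apply: nCf];
    by exists p.
have /choice[g gP] (b : T) : exists f, (fst @` M) b -> M (b, f).
  have [[[c f] Mcf <-]|nMb] := pselect ((fst @` M) b); first by exists f.
  by exists xpredT => /nMb.
exists (fst @` M), (fun b => N b `&` Y (g b)); split.
- by move=> _ [p /MS[Bp _] <-].
- rewrite (eq_countable (inj_card_eq _)) => // p q /set_mem Mp /set_mem Mq pq.
  by apply: contrapT => /(Mr p q Mp Mq)[].
- by move=> b /gP/MS[_ infb]; split=> //; exact: subIsetl.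
- move=> b c /gP Mb /gP Mc nbc.
  have [|_ /= gbc] := Mr _ _ Mb Mc; first by case.
  by apply: sub_finite_set (adY _ _ gbc) => x [[_ ?] [_ ?]].
Qed.

Theorem theorem3p3 (V : Type) (G : graph V) (A B : set V)
    (hG : aleph01_graph G A B) :
  exists (H : graph V) (A' B' : set V),
    [/\ subgraph H G, aleph01_graph H A' B' & almost_disjoint H B'].
Proof.
case: hG => -[ABV AB0 indA indB] cA [uB leB] infN.
have [C [M [CB uC MN adM]]] := almost_disjoint_refinement uB infN.
(* All of [A] is kept, but only the edges joining some [c] in [C] to [M c]; the disjunction
   symmetrises this. *)
pose E x y := edge G x y /\ (C x /\ M x y \/ C y /\ M y x).
have Esym x y : E x y -> E y x.
  by move=> [Gxy [?|?]]; (split; first exact: edge_sym); [right|left].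
have Eirr x : ~ E x x by move=> [Gxx _]; exact: edge_irrefl Gxx.
have Everts x y : E x y -> (A `|` C) x.
  move=> [Gxy [[Cx _]|[Cy _]]]; first by right.
  left; have := edge_verts Gxy; rewrite -ABV => -[//|Bx].
  by case: (indB x y Bx (CB _ Cy)).
pose H := Graph Esym Eirr Everts.
have NH c : C c -> neighbours H c = M c.
  move=> Cc; apply/seteqP; split=> [x [Gcx [[_ //]|[Cx _]]]|x Mx].
    by case: (indB c x (CB _ Cc) (CB _ Cx)).
  by split; [exact: (MN c Cc).1|left].
exists H, A, C; split.
- split=> [x|x y []//]; rewrite -ABV => -[Ax|/CB Bx]; [by left|by right].
- split=> //.
  + split=> //.
    * by apply/seteqP; split=> // x [Ax /CB Bx]; rewrite -AB0.
    * by move=> x y Ax Ay [Gxy _]; exact: indA Gxy.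
    * by move=> x y /CB Bx /CB By [Gxy _]; exact: indB Gxy.
  (* The uncountable [C] inherits minimality from [B], being a subset of it. *)
  + by split=> // W D /leB; apply: card_le_trans; exact: subset_card_le.
  + by move=> c Cc; rewrite NH//; exact: (MN c Cc).2.
- by move=> b c Cb Cc nbc; rewrite !NH//; exact: adM.
Qed.
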